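(* Let $L$ be a lattice with at least two elements, and let $n$ be a positive integer. If $k$ is a positive integer such that there is no $k$-element antichain in the direct power $L^n$, then the direct power $L^k$ is not $n$-generated. In particular, $L^k$ is not $n$-generated if $k>|L|^n$.
   Context: A lattice is $n$-generated if it has an $n$-element generating set (a set is generating if no proper sublattice contains it). Direct powers are ordered componentwise; an antichain is a set of pairwise incomparable elements. *)

(* Defs.v *)
From HB Require Import structures.
From mathcomp Require Import all_boot all_order.
From mathcomp Require Import boolp classical_sets functions cardinality.

Set Implicit Arguments.
Unset Strict Implicit.
Unset Printing Implicit Defensive.

Import Order.TTheory.
Local Open Scope classical_set_scope.
Local Open Scope card_scope.

Definition antichain (d : Order.disp_t) (T : porderType d) (A : set T) : Prop :=
  forall x y : T, A x -> A y -> x <> y -> (x >< y)%O.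

Definition sublattice (d : Order.disp_t) (T : latticeType d) (S : set T) :
    Prop :=
  [/\ S !=set0,
      forall x y : T, S x -> S y -> S (Order.meet x y) &
      forall x y : T, S x -> S y -> S (Order.join x y)].

Definition generating (d : Order.disp_t) (T : latticeType d) (X : set T) :
    Prop :=
  forall S : set T, sublattice S -> X `<=` S -> S = setT.

Definition n_generated (n : nat) (d : Order.disp_t) (T : latticeType d) :
    Prop :=
  exists2 X : set T, X #= `I_n & generating X.

(* Main.v *)
Require Import Defs.
From HB Require Import structures.
From mathcomp Require Import all_boot all_order.
From mathcomp Require Import boolp classical_sets functions cardinality.

Local Open Scope classical_set_scope.
Local Open Scope card_scope.

(** An $n$-element generating set of $L^k$ is an $n \times k$ matrix over $L$.
    If its [i]-th and [j]-th columns, read in $L^n$, satisfied [c_i <= c_j] with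
    [i <> j], all generators would lie in the proper sublattice of the [y] with
    [y_i <= y_j]; so the $k$ columns form an antichain. *)

Lemma exists_not_le {d : Order.disp_t} {L : latticeType d} :
  (exists x y : L, x <> y) -> exists a b : L, ~~ (a <= b)%O.
Proof.
move=> [x [y xy]].
case hxy: (x <= y)%O; last by exists x, y; rewrite hxy.
case hyx: (y <= x)%O; last by exists y, x; rewrite hyx.
by case: xy; apply: Order.POrderTheory.le_anti; rewrite hxy hyx.
Qed.

Lemma generating_coord_not_le {d : Order.disp_t} {L : latticeType d} {k : nat}
    {X : set (k.-tupleprod L)} {i j : 'I_k} :
  (exists x y : L, x <> y) -> generating X -> i != j ->
  exists2 x, X x & ~~ (tnth x i <= tnth x j)%O.
Proof.
move=> /exists_not_le[a [b ab]] genX ij.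
pose S := [set y : k.-tupleprod L | (tnth y i <= tnth y j)%O].
have subS : sublattice S.
  split.
  - by exists [tuple a | _ < k]; rewrite /S /= !tnth_mktuple.
  - by move=> x y Sx Sy; rewrite /S /= !Order.TupleProdOrder.tnth_meet
      Order.MeetTheory.leI2.
  - by move=> x y Sx Sy; rewrite /S /= !Order.TupleProdOrder.tnth_join
      Order.JoinTheory.leU2.
apply: contrapT => noX.
have SX : X `<=` S.
  by move=> x Xx; apply: contrapT => /negP nle; apply: noX; exists x.
(* [S] is proper: this tuple has [a] at [i] and [b] at [j], so its membership would give
   [a <= b]. *)
have : S [tuple if l == i then a else b | l < k] by rewrite (genX S subS SX).
rewrite /S /= !tnth_mktuple eqxx eq_sym (negbTE ij); exact/negP.
Qed.

(** Asking for [~~ (c i <= c j)] at all distinct indices makes the columns both incomparable and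
    pairwise distinct. *)
Lemma n_generated_incomparable {d : Order.disp_t} {L : latticeType d}
    {n k : nat} :
  (exists x y : L, x <> y) -> n_generated n (k.-tupleprod L) ->
  exists c : 'I_k -> n.-tupleprod L, forall i j, i != j -> ~~ (c i <= c j)%O.
Proof.
move=> hL [X /card_set_bijP[f [imf injf surjf]] genX].
(* [g] inverts the bijection [f] and so lists the generators as the rows of the matrix. *)
have /choice[g gP] : forall l : 'I_n, exists x, X x /\ f x = l.
  by move=> l; have [x Xx fx] := surjf l (ltn_ord l); exists x.
exists (fun i => [tuple tnth (g l) i | l < n]) => i j ij.
have [x Xx] := generating_coord_not_le hL genX ij.
apply: contra; rewrite Order.TupleProdOrder.leEtprod.
(* The row of index [f x] is [x] itself, by injectivity of [f], and there the two columns fail to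
   compare. *)
move=> /forallP/(_ (Ordinal (imf x Xx))); rewrite !tnth_mktuple.
have [Xg fg] := gP (Ordinal (imf x Xx)).
by rewrite (injf _ _ (mem_set Xg) (mem_set Xx) fg).
Qed.

Theorem mainTheorem4 (d : Order.disp_t) (L : latticeType d)
    (hL : exists x y : L, x <> y) (n k : nat) (hn : 0 < n) (hk : 0 < k) :
  (~ (exists2 A : set (n.-tupleprod L), A #= `I_k & antichain A) ->
     ~ n_generated n (k.-tupleprod L))
  /\ (forall m : nat, [set: L] #= `I_m -> m ^ n < k ->
        ~ n_generated n (k.-tupleprod L)).
Proof.
(* Equal columns would be comparable by reflexivity. *)
have injP (c : 'I_k -> n.-tupleprod L) :
    (forall i j, i != j -> ~~ (c i <= c j)%O) -> injective c.
  move=> cP i j cij; apply/eqP/negPn/negP => /cP.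
  by rewrite cij Order.POrderTheory.lexx.
split=> [noA|m Lm mk] /(n_generated_incomparable hL)[c cP].
  apply: noA; exists (range c).
    rewrite (card_eql (inj_card_eq _)) 1?card_eq_sym ?card_II //.
    by move=> i j _ _; apply: (injP c cP).
  move=> _ _ [i _ <-] [j _ <-] cij.
  have ij : i != j by apply: contra_notN cij => /eqP ->.
  by rewrite /Order.comparable negb_or cP // cP // eq_sym.
(* Pigeonhole: recoding entries through [f] embeds the [k] distinct columns into the [m ^ n] tuples
   over the finite type ['I_m]. *)
move: Lm => /card_set_bijP[f [imf injf _]].
pose h (i : 'I_k) : n.-tuple 'I_m :=
  [tuple Ordinal (imf (tnth (c i) l) I) | l < n].
have injh : injective h.
  move=> i j hij; apply: (injP c cP); apply: eq_from_tnth => l.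
  apply: injf; rewrite ?in_setT //.
  by have := congr1 (fun t => val (tnth t l)) hij; rewrite !tnth_mktuple.
by move: (leq_card h injh); rewrite card_tuple !card_ord leqNgt mk.
Qed.
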